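(* Let $f:\mathbb{R}^d\times\mathbb{R}^d\to\mathbb{R}^d$ be Borel measurable, $\phi:\mathbb{R}^d\to[0,\infty)$ a probability density with respect to Lebesgue measure, and $K(x,A)=\int_{\mathbb{R}^d}1_A(f(x,z))\phi(z)dz$. Let $R,M>0$ and $y_0\in\mathbb{R}^d$, and write $f_x=f(x,\cdot)$. Assume (i) there exists $L_f\ge0$ such that $f_x$ is $L_f$-Lipschitz for every $x\in B(0,R)$; (ii) there exists $\tilde M>0$ such that $B(y_0,M)\subset f_x(B(0,\tilde M))$ for all $x\in B(0,R)$; (iii) $\phi$ is lower semicontinuous and positive on $\mathbb{R}^d$. Then for all $x\in B(0,R)$ and all Borel $A\subset\mathbb{R}^d$, $$K(x,A)\ge L_f^{-d}\inf_{z\in B(0,\tilde M)}\{\phi(z)\}\,\mathrm{Leb}(A\cap B(y_0,M)).$$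
   Context: $B(x,r)$ denotes the Euclidean ball centered at $x$ of radius $r$, and $\mathrm{Leb}$ the Lebesgue measure on $\mathbb{R}^d$. *)

(* Defs.v *)
From HB Require Import structures.
From mathcomp Require Import all_boot all_order all_algebra.
From mathcomp Require Import all_classical all_reals all_analysis.
Set Implicit Arguments. Unset Strict Implicit. Unset Printing Implicit Defensive.
Import Order.TTheory GRing.Theory Num.Theory.
Local Open Scope classical_set_scope.
Local Open Scope ring_scope.

(* R^d is modelled as d.-tuple R, equipped with the library's product
   sigma-algebra of d copies of the Borel sigma-algebra of R
   (= Borel sigma-algebra of R^d). *)
Notation Rd R d := (d.-tuple R).

Definition edist (R : realType) (d : nat) (x y : Rd R d) : R :=
  Num.sqrt (\sum_(i < d) (tnth x i - tnth y i) ^+ 2).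

Definition origin (R : realType) (d : nat) : Rd R d := [tuple (0 : R) | i < d].

Definition eball (R : realType) (d : nat) (c : Rd R d) (r : R) : set (Rd R d) :=
  [set y | edist c y < r].

Definition box (R : realType) (d : nat) (ab : Rd R d * Rd R d) : set (Rd R d) :=
  [set x | forall i : 'I_d, tnth ab.1 i < tnth x i <= tnth ab.2 i].
Definition box_vol (R : realType) (d : nat) (ab : Rd R d * Rd R d) : \bar R :=
  (\prod_(i < d) Num.max (tnth ab.2 i - tnth ab.1 i) 0)%:E.

(* Lebesgue (outer) measure on R^d: infimum of the total volume of countable
   coverings by boxes.  On Borel sets this is the Lebesgue measure. *)
Definition leb (R : realType) (d : nat) (A : set (Rd R d)) : \bar R :=
  ereal_inf [set (\sum_(0 <= k <oo) box_vol (B k))%E |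
             B in [set B : nat -> Rd R d * Rd R d |
                    A `<=` \bigcup_k box (B k)]].

Definition lipschitz_with (R : realType) (d : nat) (L : R) (g : Rd R d -> Rd R d) :=
  forall z w, edist (g z) (g w) <= L * edist z w.

Definition lsc_euclid (R : realType) (d : nat) (phi : Rd R d -> R) :=
  forall z (e : R), 0 < e ->
    exists2 delta : R, 0 < delta &
      forall w, edist z w < delta -> phi z - e < phi w.

Definition prob_density (R : realType) (d : nat) (phi : Rd R d -> R) :=
  [/\ measurable_fun [set: Rd R d] phi,
      (forall z, 0 <= phi z) &
      (\int[@leb R d]_(z in [set: Rd R d]) (phi z)%:E = 1)%E].

Definition Kker (R : realType) (d : nat) (f : Rd R d -> Rd R d -> Rd R d)
  (phi : Rd R d -> R) (x : Rd R d) (A : set (Rd R d)) : \bar R :=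
  (\int[@leb R d]_(z in [set: Rd R d]) (\1_A (f x z) * phi z)%:E)%E.

(* Main.v *)
(* The key fact is that an L-Lipschitz map g of R^d satisfies
   leb (g E) <= L^d leb E, with the sharp constant for the Euclidean norm.
   A crude constant C, valid on all boxes whose sides are comparable, is
   obtained by enclosing such a box in a ball.  It improves itself: a fixed
   proportion theta of the box is filled by an inscribed ball, whose image lies
   in a ball and so has volume at most L^d times as large, while the rest of
   the box satisfies the bound with C, whence C - (C - L^d) theta also works.
   Iterating, the excess over L^d decays geometrically.
   With E = f_x^-1(A) /\ B(0, Mt), which f_x maps onto a set containing
   A /\ B(y0, M), the theorem follows from K(x, A) >= inf phi * leb E. *)
Require Import Defs.
From HB Require Import structures.
From mathcomp Require Import all_boot all_order all_algebra.
From mathcomp Require Import all_classical all_reals all_analysis.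
From mathcomp Require Import measurable_realfun ring lra.
Set Implicit Arguments.
Unset Strict Implicit.
Unset Printing Implicit Defensive.
Import Order.TTheory GRing.Theory Num.Theory.
(* Importing [Defs] again restores [edist], which mathcomp-analysis shadows. *)
Import numFieldNormedType.Exports Defs.
Local Open Scope classical_set_scope.
Local Open Scope ring_scope.

(** * Lebesgue outer measure in positive dimension and its restriction to Borel sets *)

Section lebesgue_outer_measure.
Context {R : realType} {n : nat}.
Local Notation d := n.+1.
Implicit Types (A E : set (Rd R d)) (ab : Rd R d * Rd R d).

Lemma box_vol_ge0 ab : (0 <= box_vol ab)%E.
Proof. by rewrite lee_fin prodr_ge0// => i _; rewrite le_max lexx orbT. Qed.

Lemma box_vol_eq0 ab (i : 'I_d) :
  tnth ab.2 i <= tnth ab.1 i -> box_vol ab = 0%E.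
Proof.
move=> abi; rewrite /box_vol (bigD1 i)//= (_ : Num.max _ _ = 0) ?mul0r//.
by apply/max_idPr; rewrite subr_le0.
Qed.

Lemma leb_ge0 A : (0 <= leb A)%E.
Proof.
apply: le_ereal_inf_tmp => _ [B _ <-].
by apply: nneseries_ge0 => *; exact: box_vol_ge0.
Qed.

Lemma leb_le_cover A (B : nat -> Rd R d * Rd R d) :
  A `<=` \bigcup_k box (B k) -> (leb A <= \sum_(0 <= k <oo) box_vol (B k))%E.
Proof. by move=> AB; apply: ereal_inf_lbound; exists B. Qed.

Lemma leb_box ab : (leb (box ab) <= box_vol ab)%E.
Proof.
(* The cover is padded with degenerate boxes, of volume 0 since there is at least one coordinate. *)
pose B k := if k is 0%N then ab else (origin R d, origin R d).
have <- : (\sum_(0 <= k <oo) box_vol (B k) = box_vol ab)%E.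
  rewrite nneseries_recl//; last by move=> *; exact: box_vol_ge0.
  rewrite eseries_cond/= eseries0 ?adde0// => -[|k]//= _ _.
  exact: (@box_vol_eq0 _ ord0).
by apply: leb_le_cover => x abx; exists 0%N.
Qed.

Lemma leb0 : leb (@set0 (Rd R d)) = 0%E.
Proof.
apply/eqP; rewrite eq_le leb_ge0 andbT.
rewrite -(@box_vol_eq0 (origin R d, origin R d) ord0)//.
by apply: le_trans (leb_box _); apply: ereal_inf_le_tmp => _ [B _ <-]; exists B.
Qed.

Lemma le_leb A E : A `<=` E -> (leb A <= leb E)%E.
Proof.
move=> AE; apply: ereal_inf_le_tmp => _ [B EB <-]; exists B => //=.
exact: subset_trans EB.
Qed.

Lemma leb_cover_adherent A (e : R) : leb A \is a fin_num -> 0 < e ->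
  exists2 B : nat -> Rd R d * Rd R d, A `<=` \bigcup_k box (B k) &
    (\sum_(0 <= k <oo) box_vol (B k) <= leb A + e%:E)%E.
Proof.
move=> Afin e0; have [_ [B AB <-] /ltW ltB] := lb_ereal_inf_adherent e0 Afin.
by exists B.
Qed.

(** Unless some term is infinite, each [F k] has a cover within [e / 2 ^ k.+1] of its measure; a
    bijection from [nat] to [nat * nat] merges these covers into one. *)
Lemma leb_sigma_subadditive : sigma_subadditive (@leb R d).
Proof.
move=> F; have [[i ioo]|Foo] := pselect (exists i, leb (F i) = +oo%E).
  rewrite (eseries_pinfty _ _ ioo) ?leey// => k _.
  by rewrite -ltNye (lt_le_trans _ (leb_ge0 _)).
apply/lee_addgt0Pr => e e0.
apply: (le_trans _ (epsilon_trick xpredT (fun k => leb_ge0 (F k)) (ltW e0))).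
have /choice[G GP] k : exists B : nat -> Rd R d * Rd R d,
    F k `<=` \bigcup_j box (B j) /\
    (\sum_(0 <= j <oo) box_vol (B j) <= leb (F k) + (e / (2 ^ k.+1)%:R)%:E)%E.
  have [||B] := @leb_cover_adherent (F k) (e / (2 ^ k.+1)%:R); last by exists B.
    rewrite ge0_fin_numE ?leb_ge0// ltey; apply/eqP => Fk.
    by apply: Foo; exists k.
  by rewrite divr_gt0// ltr0n expn_gt0.
have /card_esym/ppcard_eqP[f] := card_nat2.
have bf : set_bij setT setT f by exact: 'bij_f.
have vG0 i j : (0 <= box_vol (G i j))%E by exact: box_vol_ge0.
apply: (@le_trans _ _ (\sum_(0 <= k <oo) box_vol (G (f k).1 (f k).2))%E).
  apply: leb_le_cover => x [i _ /(GP i).1[j _ Gx]].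
  have [_ _ /(_ (i, j) I)[k _ fk]] := bf.
  by exists k => //=; rewrite fk.
rewrite nneseries_esumT//.
rewrite -(@reindex_esum R _ _ setT setT f (fun p => box_vol (G p.1 p.2)))//.
rewrite [X in (esum X _ <= _)%E](_ : _ = setT `*`` (fun=> setT)); last first.
  by apply/seteqP; split.
rewrite -(esum_esum (a := fun i j => box_vol (G i j)))//.
rewrite -nneseries_esumT; last by move=> k; exact: esum_ge0.
apply: lee_nneseries => [k _ _|k _]; first exact: esum_ge0.
by rewrite -nneseries_esumT//; exact: (GP k).2.
Qed.

HB.instance Definition _ := isOuterMeasure.Build R (Rd R d) (@leb R d)
  leb0 leb_ge0 le_leb leb_sigma_subadditive.

(** Images of covering boxes cover the image; positivity of [C] lets it pass through the infimum by
    division. *)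
Lemma leb_image_le (g : Rd R d -> Rd R d) (C : R) : 0 < C ->
  (forall ab, (leb (g @` box ab) <= C%:E * box_vol ab)%E) ->
  forall A, (leb (g @` A) <= C%:E * leb A)%E.
Proof.
move=> C0 gC A; rewrite -lee_pdivrMl//; apply: le_ereal_inf_tmp => _ [B AB <-].
rewrite lee_pdivrMl// -nneseriesZl; last by move=> *; exact: box_vol_ge0.
apply: (@le_trans _ _ (\sum_(0 <= k <oo) leb (g @` box (B k)))%E); last first.
  by apply: lee_nneseries => // *; exact: leb_ge0.
apply: le_trans (outer_measure_sigma_subadditive _ _).
apply: le_outer_measure => _ [x /AB[k _ Bx] <-]; by exists k.
Qed.

(** Taking [Num.max] here and [Num.min] below covers hyperplanes that miss the box: one piece is
    then empty with volume 0, the other is the whole box. *)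
Definition cut_above (i : 'I_d) (a : R) ab : Rd R d * Rd R d :=
  ([tuple if j == i then Num.max (tnth ab.1 j) a else tnth ab.1 j | j < d],
   ab.2).

Definition cut_below (i : 'I_d) (a : R) ab : Rd R d * Rd R d :=
  (ab.1,
   [tuple if j == i then Num.min (tnth ab.2 j) a else tnth ab.2 j | j < d]).

Lemma box_cut_above i a ab :
  box (cut_above i a ab) = box ab `&` [set x | a < tnth x i].
Proof.
apply/seteqP; split=> x /=.
  move=> abx; split=> [j|]; last first.
    by have := abx i; rewrite tnth_mktuple eqxx gt_max => /andP[/andP[]].
  have := abx j; rewrite tnth_mktuple; case: ifP => // _.
  by rewrite gt_max => /andP[/andP[-> _] ->].
move=> [abx ax] j; rewrite tnth_mktuple; case: ifPn => // /eqP ->.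
by rewrite gt_max ax andbT.
Qed.

Lemma box_cut_below i a ab :
  box (cut_below i a ab) = box ab `&` ~` [set x | a < tnth x i].
Proof.
apply/seteqP; split=> x /=.
  move=> abx; split=> [j|]; last first.
    have := abx i; rewrite tnth_mktuple eqxx le_min => /andP[_ /andP[_]].
    by move=> xa; apply/negP; rewrite -leNgt.
  have := abx j; rewrite tnth_mktuple; case: ifP => // _.
  by rewrite le_min => /andP[-> /andP[-> _]].
move=> [abx /negP]; rewrite -leNgt => ax j.
rewrite tnth_mktuple; case: ifPn => // /eqP ->.
by rewrite le_min ax andbT.
Qed.

Lemma box_vol_cut i a ab :
  (box_vol (cut_above i a ab) + box_vol (cut_below i a ab) = box_vol ab)%E.
Proof.
rewrite /box_vol -EFinD; congr EFin.
rewrite (bigD1 i)//= [X in _ + X](bigD1 i)//= [RHS](bigD1 i)//=.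
rewrite !tnth_mktuple eqxx.
under eq_bigr => j ji do rewrite tnth_mktuple (negbTE ji).
under [X in _ + _ * X]eq_bigr => j ji do rewrite tnth_mktuple (negbTE ji).
rewrite -mulrDl; congr (_ * _).
move: (tnth ab.1 i) (tnth ab.2 i) => x y.
by case: (leP x a) => ?; case: (leP y a) => ?; do ![case: leP => ?]; lra.
Qed.

(** Cutting every box of a cover of [X] along the hyperplane yields covers of both parts of [X] with
    the same total volume. *)
Lemma halfspace_caratheodory i a :
  (@leb R d).-caratheodory [set x | a < tnth x i].
Proof.
apply: le_caratheodory_measurable => X.
apply: le_ereal_inf_tmp => _ [B XB <-].
under eq_eseriesr do rewrite -(box_vol_cut i a).
rewrite nneseriesD; [|by move=> *; exact: box_vol_ge0..].
apply: leeD; apply: leb_le_cover => x [/XB[k _ Bx] ax]; exists k => //.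
  by rewrite box_cut_above.
by rewrite box_cut_below.
Qed.

(** Caratheodory sets form a sigma-algebra containing the coordinate half-spaces, which generate the
    Borel sets; this is phrased as measurability of the identity map. *)
Lemma measurable_caratheodory A : measurable A -> (@leb R d).-caratheodory A.
Proof.
pose T : measurableType _ := Rd R d.
pose mu : {outer_measure set T -> \bar R} := @leb R d.
have mid : @measurable_fun (caratheodory_display mu) _
    (caratheodory_type mu) T setT id.
  apply/measurable_fun_tnthP => i.
  apply: (measurability _ (RGenOInfty.measurableE R)) => _ [_ [a ->] <-].
  rewrite setTI (_ : _ @^-1` _ = [set x | a < tnth x i]).
    exact: halfspace_caratheodory.
  by apply/seteqP; split => x /=; rewrite in_itv/= andbT.
by move=> mA; have := mid measurableT _ mA; rewrite setTI.
Qed.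

Lemma leb_semi_sigma_additive : semi_sigma_additive (@leb R d).
Proof.
move=> F mF tF mUF.
apply: (@caratheodory_measure_sigma_additive R (Rd R d : measurableType _)
  (@leb R d)) => //.
  by move=> k; exact: measurable_caratheodory.
exact: measurable_caratheodory.
Qed.

HB.instance Definition _ := isMeasure.Build _ (Rd R d) R (@leb R d)
  leb0 leb_ge0 leb_semi_sigma_additive.

End lebesgue_outer_measure.

(** * Volumes of Euclidean balls *)

Section euclidean_balls.
Context {R : realType} {n : nat}.
Local Notation d := n.+1.
Implicit Types (x y c : Rd R d).

Lemma edist_ge_coord x y i : `|tnth x i - tnth y i| <= edist x y.
Proof.
rewrite -sqrtr_sqr ler_sqrt ?sumr_ge0//; last by move=> *; exact: sqr_ge0.
by rewrite (bigD1 i)//= lerDl sumr_ge0// => *; exact: sqr_ge0.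
Qed.

(** The crude factor [d + 1], in place of the square root of [d], makes the bound strict, as open
    balls require: [d < (d + 1) ^ 2]. *)
Lemma edist_lt_coord x y (t : R) : 0 < t ->
  (forall i, `|tnth x i - tnth y i| <= t) -> edist x y < n.+2%:R * t.
Proof.
move=> t0 xyt; have nt0 : 0 < n.+2%:R * t :> R by rewrite mulr_gt0.
rewrite -[ltRHS](ger0_norm (ltW nt0)) -sqrtr_sqr ltr_sqrt ?exprn_gt0//.
apply: (@le_lt_trans _ _ (\sum_(i < d) t ^+ 2)).
  apply: ler_sum => i _; rewrite -(real_normK (num_real _)).
  by rewrite lerXn2r ?nnegrE ?(ltW t0).
rewrite sumr_const card_ord -[_ *+ _]mulr_natl exprMn ltr_pM2r ?exprn_gt0//.
by rewrite -natrX ltr_nat; exact: (@leq_pmulr n.+2 n.+2).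
Qed.

Lemma measurable_eball c r : measurable (eball c r).
Proof.
rewrite (_ : eball c r = edist c @^-1` `]-oo, r[); last first.
  by apply/seteqP; split => x; rewrite /eball/= in_itv.
rewrite -[X in measurable X]setTI.
suff : measurable_fun setT (edist c) by apply => //; exact: measurable_itv.
apply: measurableT_comp.
  by apply: continuous_measurable_fun; exact: sqrt_continuous.
apply: measurable_sum => i; apply: measurable_funX; apply: measurable_funB.
  exact: measurable_cst.
exact: measurable_tnth.
Qed.

(** With separate source and target centres, one such map carries any ball onto any other, and its
    inverse has the same form. *)
Definition homothety c c' (r : R) x : Rd R d :=
  [tuple tnth c' i + r * (tnth x i - tnth c i) | i < d].

Lemma edist_homothety c c' r x : 0 <= r ->
  edist c' (homothety c c' r x) = r * edist c x.
Proof.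
move=> r0; rewrite -[X in X * _](ger0_norm r0) -sqrtr_sqr -sqrtrM ?sqr_ge0//.
congr Num.sqrt; rewrite mulr_sumr; apply: eq_bigr => i _.
by rewrite tnth_mktuple; ring.
Qed.

Lemma homothetyK c c' r : r != 0 ->
  cancel (homothety c c' r) (homothety c' c r^-1).
Proof.
move=> r0 x; apply: eq_from_tnth => i; rewrite !tnth_mktuple.
by rewrite [_ + _ - _]addrAC subrr add0r mulKf// addrC subrK.
Qed.

Lemma leb_homothety c c' r (E : set (Rd R d)) : 0 < r ->
  (leb (homothety c c' r @` E) <= (r ^+ d)%:E * leb E)%E.
Proof.
move=> r0; apply: leb_image_le => [|ab]; first exact: exprn_gt0.
pose h := homothety c c' r.
apply: (@le_trans _ _ (leb (box (h ab.1, h ab.2)))).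
  apply: le_leb => _ [x abx <-] i; rewrite /= !tnth_mktuple.
  by rewrite ltrD2l lerD2l ltr_pM2l// ler_pM2l// ltrD2r lerD2r.
apply: le_trans (leb_box _) _.
rewrite /box_vol -EFinM lee_fin -[X in r ^+ X]card_ord -prodr_const.
rewrite -big_split/=.
apply: ler_prod => i _; rewrite le_max lexx orbT/= !tnth_mktuple.
rewrite (_ : _ - _ = r * (tnth ab.2 i - tnth ab.1 i)); last by ring.
by rewrite maxr_pMr ?mulr0// ltW.
Qed.

(** The value is never computed: only the bounds 0 and [2 ^ d] enter the argument. *)
Definition unit_ball_vol : R := fine (leb (eball (origin R d) 1)).

Lemma leb_unit_ball_le : (leb (eball (origin R d) 1) <= (2 ^+ d)%:E)%E.
Proof.
pose cube := ([tuple -1 | i < d], [tuple 1 | i < d]) : Rd R d * Rd R d.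
have <- : box_vol cube = (2 ^+ d)%:E.
  rewrite /box_vol -[X in 2 ^+ X]card_ord -prodr_const; congr EFin.
  by apply: eq_bigr => i _; rewrite /= !tnth_mktuple max_l; lra.
apply: le_trans (leb_box _); apply: le_leb => x /= x1 i.
have := le_lt_trans (edist_ge_coord (origin R d) x i) x1.
by rewrite !tnth_mktuple sub0r normrN ltr_norml => /andP[-> /ltW].
Qed.

Lemma unit_ball_volE : leb (eball (origin R d) 1) = unit_ball_vol%:E.
Proof.
rewrite fineK// ge0_fin_numE ?leb_ge0//.
by apply: le_lt_trans leb_unit_ball_le _; rewrite ltry.
Qed.

Lemma unit_ball_vol_ge0 : 0 <= unit_ball_vol.
Proof. by rewrite -lee_fin -unit_ball_volE leb_ge0. Qed.

Lemma unit_ball_vol_le : unit_ball_vol <= 2 ^+ d.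
Proof. by rewrite -lee_fin -unit_ball_volE leb_unit_ball_le. Qed.

(** Homotheties are only known to give upper bounds, so one of ratio [r] from the unit ball and one
    of ratio [r^-1] back to it yield the two inequalities. *)
Lemma leb_eball c r : 0 < r -> leb (eball c r) = (r ^+ d * unit_ball_vol)%:E.
Proof.
move=> r0; have rV0 : 0 < r^-1 by rewrite invr_gt0.
have sub c1 c2 s t : 0 < s -> 0 < t ->
    eball c1 t `<=` homothety c2 c1 s @` eball c2 (s^-1 * t).
  move=> s0 t0 x /= xt; exists (homothety c1 c2 s^-1 x).
    by rewrite /eball /= edist_homothety ?ltr_pM2l ?invr_ge0 ?invr_gt0// ltW.
  by rewrite -{1}(invrK s) homothetyK// invr_eq0 gt_eqF.
apply/eqP; rewrite eq_le; apply/andP; split.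
  have := le_leb (sub c (origin R d) _ _ r0 r0).
  rewrite mulVf ?gt_eqF// => /le_trans; apply.
  by rewrite EFinM -unit_ball_volE; exact: leb_homothety.
have := le_leb (sub (origin R d) c _ _ rV0 ltr01).
rewrite invrK mulr1 => /le_trans.
move=> /(_ _ (leb_homothety _ _ _ rV0)).
rewrite unit_ball_volE exprVn -lee_pdivrMl ?invr_gt0 ?exprn_gt0//.
by rewrite invrK EFinM.
Qed.

End euclidean_balls.

(** * Lipschitz images and the sharp constant *)

Section lipschitz_image.
Context {R : realType} {n : nat}.
Local Notation d := n.+1.
Local Notation v := (@unit_ball_vol R n).
Implicit Types (ab : Rd R d * Rd R d) (m C : R).

Definition side ab (i : 'I_d) : R := tnth ab.2 i - tnth ab.1 i.

Lemma box_vol_side ab : (forall i, 0 <= side ab i) ->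
  box_vol ab = (\prod_(i < d) side ab i)%:E.
Proof.
by move=> ab0; congr EFin; apply: eq_bigr => i _; apply/max_idPl/ab0.
Qed.

(** Bounded side ratios make the box comparable to balls inside and around it. The factor 2 suits
    cutting: taking [m] off a side of at least [2 * m] leaves two sides of at least [m]. *)
Definition near_cube m ab := forall i, m <= side ab i < 2 * m.

Context (g : Rd R d -> Rd R d) (L : R).
Context (L_gt0 : 0 < L) (gL : lipschitz_with L g).

Definition expands C := forall m ab, 0 < m -> near_cube m ab ->
  (leb (g @` box ab) <= C%:E * box_vol ab)%E.

Lemma expands_le C C' : C <= C' -> expands C -> expands C'.
Proof.
move=> CC' gC m ab m0 abm; apply: le_trans (gC _ _ m0 abm) _.
by rewrite lee_wpmul2r ?box_vol_ge0// lee_fin.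
Qed.

Lemma expands_box C ab : expands C ->
  (leb (g @` box ab) <= C%:E * box_vol ab)%E.
Proof.
move=> gC; have [[i abi]|ab0] := pselect (exists i, side ab i <= 0).
  rewrite (_ : box ab = set0).
    rewrite image_set0 leb0 (box_vol_eq0 (i := i)) ?mule0//.
    by rewrite -subr_le0.
  apply/seteqP; split => // x /(_ i) /andP[ax xb].
  by have := lt_le_trans ax xb; rewrite -subr_gt0 ltNge abi.
have {}ab0 i : 0 < side ab i.
  by rewrite ltNge; apply/negP => abi; apply: ab0; exists i.
have [m m0 mab] : exists2 m, 0 < m & forall i, m <= side ab i.
  have [//|i _ imin] := @arg_minP _ _ _ ord0 xpredT (side ab).
  by exists (side ab i) => // j; exact: imin.
(* The sum of the sides, in units of [m], drives the induction: each piece of a cut loses at least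
   [m] from it. *)
have [k] : exists k : nat, \sum_(i < d) side ab i <= k%:R * m.
  exists (Num.bound ((\sum_(i < d) side ab i) / m)).
  rewrite -ler_pdivrMr// ltW// archi_boundP// divr_ge0 ?(ltW m0)//.
  by apply: sumr_ge0 => i _; exact: ltW.
(* Slabs of thickness [m] are cut off until all sides are below [2 * m]. *)
clear ab0; elim: k ab mab => [|k IHk] ab mab abk.
  have := lt_le_trans m0 (mab ord0).
  move: abk; rewrite mul0r (bigD1 ord0)//=.
  have : 0 <= \sum_(i < d | i != ord0) side ab i.
    by apply: sumr_ge0 => i _; exact: le_trans (ltW m0) (mab i).
  by move=> ? ? ?; exfalso; lra.
have [[i abi]|abm] := pselect (exists i, 2 * m <= side ab i); last first.
  apply: (gC m) => // i; rewrite mab/= ltNge; apply/negP => abi.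
  by apply: abm; exists i.
pose a := tnth ab.1 i + m.
have sideA j :
    side (cut_above i a ab) j = if j == i then side ab i - m else side ab j.
  rewrite /side tnth_mktuple/=; case: eqP => // ->.
  by rewrite max_r ?lerDl ?(ltW m0)// /a opprD addrA.
have sideB j : side (cut_below i a ab) j = if j == i then m else side ab j.
  rewrite /side tnth_mktuple/=; case: eqP => // ->.
  rewrite min_r /a; first by rewrite addrAC subrr add0r.
  by rewrite -lerBrDl (le_trans _ abi)// ler_peMl ?(ltW m0)// ler1n.
have -> : box ab = box (cut_above i a ab) `|` box (cut_below i a ab).
  by rewrite box_cut_above box_cut_below -setIUr setUv setIT.
rewrite image_setU -(box_vol_cut i a) ge0_muleDr ?box_vol_ge0//.
apply: le_trans (outer_measureU2 _ _ _) _.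
have sumE (F : 'I_d -> R) y :
    (forall j, F j = if j == i then y else side ab j) ->
    \sum_(j < d) F j = y + (\sum_(j < d) side ab j - side ab i).
  move=> Fj; rewrite (bigD1 i)//= [in RHS](bigD1 i)//= Fj eqxx.
  rewrite [X in _ = _ + X]addrAC subrr add0r; congr (_ + _).
  by apply: eq_bigr => j /negbTE ji; rewrite Fj ji.
have [sA sB] : \sum_(j < d) side (cut_above i a ab) j <= k%:R * m /\
    \sum_(j < d) side (cut_below i a ab) j <= k%:R * m.
  rewrite (sumE _ _ sideA) (sumE _ _ sideB); move: abk.
  by rewrite -natr1 mulrDl mul1r; move: (k%:R * m) => km ?; split; lra.
apply: leeD; apply: IHk => // j; rewrite ?sideA ?sideB; case: eqP => // _.
by lra.
Qed.

Lemma expands_leb C : 0 < C -> expands C ->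
  forall E, (leb (g @` E) <= C%:E * leb E)%E.
Proof. by move=> C0 gC; apply: leb_image_le => // ab; exact: expands_box. Qed.

(** The image lies in the ball of radius [L * r] about [g c]. This is where the Lipschitz condition
    enters, and the source of the sharp factor [L ^ d]. *)
Lemma leb_image_eball c r : 0 < r ->
  (leb (g @` eball c r) <= ((L * r) ^+ d * v)%:E)%E.
Proof.
move=> r0; rewrite -(leb_eball (g c)) ?mulr_gt0//; apply: le_leb => _ [x cx <-].
by apply: le_lt_trans (gL _ _) _; rewrite ltr_pM2l.
Qed.

Lemma near_cube_vol m ab : 0 < m -> near_cube m ab ->
  exists2 V, box_vol ab = V%:E & m ^+ d <= V <= (2 * m) ^+ d.
Proof.
move=> m0 abm; exists (\prod_(i < d) side ab i).
  by apply: box_vol_side => i; have /andP[+ _] := abm i; exact/le_trans/ltW.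
have prodE (y : R) : y ^+ d = \prod_(i < d) y by rewrite prodr_const card_ord.
rewrite !prodE; apply/andP; split.
  by apply: ler_prod => i _; have /andP[-> _] := abm i; rewrite ltW.
apply: ler_prod => i _; have /andP[mi /ltW ->] := abm i.
by rewrite (le_trans (ltW m0)).
Qed.

Lemma expands_init : expands ((L * (2 * n.+2%:R)) ^+ d * v).
Proof.
move=> m ab m0 abm; have [V -> /andP[mV _]] := near_cube_vol m0 abm.
(* The ball of this radius about the lower corner contains the box, whose sides are below
   [2 * m]. *)
pose r := n.+2%:R * (2 * m).
have r0 : 0 < r by rewrite !mulr_gt0.
apply: (@le_trans _ _ ((L * r) ^+ d * v)%:E).
  apply: le_trans (leb_image_eball ab.1 r0); apply: le_leb; apply: image_subset.
  move=> x abx; apply: edist_lt_coord => [|i]; first by rewrite mulr_gt0.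
  have := abm i; have := abx i; rewrite /side => /andP[ax xb] /andP[_ abi].
  by rewrite ler_norml; apply/andP; split; lra.
rewrite -EFinM lee_fin (_ : L * r = L * (2 * n.+2%:R) * m); last first.
  by rewrite /r; ring.
rewrite exprMn mulrAC ler_wpM2l// mulr_ge0 ?unit_ball_vol_ge0//.
by rewrite exprn_ge0// !mulr_ge0// ltW.
Qed.

Lemma expands_improve C : L ^+ d <= C -> expands C ->
  expands (C - (C - L ^+ d) * (v / 4 ^+ d)).
Proof.
move=> LC gC m ab m0 abm; have [V VE /andP[mV Vm]] := near_cube_vol m0 abm.
have C0 : 0 < C by apply: lt_le_trans LC; exact: exprn_gt0.
(* All sides are at least [m], so the ball of radius [m / 2] about the centre [c] fits in the
   box. *)
pose c : Rd R d := [tuple tnth ab.1 i + side ab i / 2 | i < d].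
have m20 : 0 < m / 2 by rewrite divr_gt0.
pose B := eball c (m / 2); pose b := (m / 2) ^+ d * v.
have Bab : B `<=` box ab.
  move=> x cx i; have := le_lt_trans (edist_ge_coord c x i) cx.
  rewrite tnth_mktuple /side ltr_norml => /andP[].
  by have := abm i; rewrite /side => /andP[? ?] ? ?; apply/andP; split; lra.
(* The ball is Borel, so it splits the outer measure of the box additively. *)
have bV : (b%:E + leb (box ab `\` B) <= V%:E)%E.
  rewrite -VE; apply: le_trans (leb_box ab); rewrite -(leb_eball c)//.
  have /(_ (box ab)) -> := measurable_caratheodory (measurable_eball c (m / 2)).
  by rewrite (setIidr Bab).
have /fineK lE : leb (box ab `\` B) \is a fin_num.
  rewrite ge0_fin_numE ?leb_ge0//; apply: le_lt_trans (le_leb _) _; last first.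
    by apply: le_lt_trans (leb_box ab) _; rewrite VE ltry.
  by move=> x [].
move: bV; rewrite -lE; set l := fine _ in lE *; rewrite -EFinD lee_fin => bV.
(* The power of 4 arises because [V <= (2 * m) ^ d] and [m / 2] is a quarter of [2 * m]. *)
have thetaV : v / 4 ^+ d * V <= b.
  apply: (@le_trans _ _ (v / 4 ^+ d * (2 * m) ^+ d)).
    by rewrite ler_wpM2l// divr_ge0 ?unit_ball_vol_ge0// exprn_ge0.
  rewrite le_eqVlt; apply/orP; left; apply/eqP.
  rewrite /b (_ : m / 2 = 4^-1 * (2 * m)); last by field.
  by rewrite [in RHS]exprMn exprVn mulrAC [RHS]mulrC mulrA mulrAC.
apply: (@le_trans _ _ ((L ^+ d * b)%:E + (C * l)%:E)%E).
  rewrite -{1}(setDUK Bab) image_setU.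
  apply: le_trans (outer_measureU2 _ _ _) _.
  (* What remains outside the ball is not a box, so the bound with [C] is used for arbitrary
     sets. *)
  apply: leeD; last by rewrite EFinM lE; exact: expands_leb.
  apply: le_trans (leb_image_eball c m20) _.
  by rewrite lee_fin exprMn mulrA.
rewrite VE -EFinD -EFinM lee_fin.
have CL : 0 <= C - L ^+ d by rewrite subr_ge0.
(* From [b + l <= V], the sum [L ^ d * b + C * l] is at most [C * V - (C - L ^ d) * b]. *)
have := ler_wpM2l CL thetaV; have := ler_wpM2l (ltW C0) bV.
move: (v / _) => t.
by rewrite !mulrBl !mulrDr => ? ?; lra.
Qed.

Lemma expands_near e : 0 < e ->
  exists C, [/\ 0 < C, C < L ^+ d + e & expands C].
Proof.
move=> e0; have Ld0 : 0 < L ^+ d by exact: exprn_gt0.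
pose D := (L * (2 * n.+2%:R)) ^+ d * v.
have D0 : 0 <= D.
  by rewrite mulr_ge0 ?unit_ball_vol_ge0// exprn_ge0// !mulr_ge0// ltW.
pose t := v / 4 ^+ d.
have t1 : t <= 1.
  rewrite ler_pdivrMr ?exprn_gt0// mul1r (le_trans unit_ball_vol_le)//.
  by rewrite lerXn2r ?nnegrE// ler_nat.
(* The start [L ^ d + D] exceeds the crude constant [D] and is at least [L ^ d]; each improvement
   multiplies the excess by [1 - t]. *)
have gC k : expands (L ^+ d + D * (1 - t) ^+ k).
  elim: k => [|k IHk].
    by rewrite expr0 mulr1; apply: expands_le expands_init; rewrite lerDr ltW.
  rewrite (_ : _ + _ = (L ^+ d + D * (1 - t) ^+ k) -
      (L ^+ d + D * (1 - t) ^+ k - L ^+ d) * t); last first.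
    by rewrite [_ ^+ k.+1]exprS; ring.
  by apply: expands_improve; rewrite // lerDl mulr_ge0// exprn_ge0// subr_ge0.
(* If [v] were 0, the excess would not shrink, but [D] would be 0 and [L ^ d] itself would do. *)
have [v0|v0] := eqVneq v 0.
  exists (L ^+ d); split => //; first by rewrite ltrDl.
  by have := gC 0%N; rewrite /D v0 mulr0 mul0r addr0.
have t0 : 0 < t.
  by rewrite divr_gt0 ?exprn_gt0// lt_neqAle eq_sym v0 unit_ball_vol_ge0.
have t01 : `|1 - t| < 1 by rewrite ger0_norm ?subr_ge0// ltrBlDr ltrDl.
(* The denominator [D + 1] is positive from [0 <= D] alone and still dominates [D]. *)
have eD0 : 0 < e / (D + 1) by rewrite divr_gt0// ltr_wpDl.
have [k tk] := filter_ex (cvgr0_norm_lt _ (cvg_expr t01) _ eD0).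
exists (L ^+ d + D * (1 - t) ^+ k); split => //.
  by rewrite ltr_wpDr// mulr_ge0// exprn_ge0// subr_ge0.
rewrite ltrD2l; move: tk.
rewrite ger0_norm ?exprn_ge0 ?subr_ge0// ltr_pdivlMr ?ltr_wpDl//.
apply: le_lt_trans; rewrite mulrC ler_wpM2l ?exprn_ge0 ?subr_ge0//.
by rewrite lerDl.
Qed.

(** Constants arbitrarily close to [L ^ d] are available; for finite [leb E] the tolerance is scaled
    by [leb E + 1] so that the total error is at most [e]. *)
Lemma lipschitz_leb E : (leb (g @` E) <= (L ^+ d)%:E * leb E)%E.
Proof.
have [Eoo|Efin] := eqVneq (leb E) +oo%E.
  by rewrite Eoo gt0_muley ?leey// lte_fin exprn_gt0.
have /fineK lE : leb E \is a fin_num by rewrite ge0_fin_numE ?leb_ge0// ltey.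
have l0 : 0 <= fine (leb E) by rewrite fine_ge0// leb_ge0.
apply/lee_addgt0Pr => e e0.
have /expands_near[C [C0 Ce gC]] : 0 < e / (fine (leb E) + 1).
  by rewrite divr_gt0// ltr_wpDl.
apply: le_trans (expands_leb C0 gC E) _; rewrite -lE -!EFinM -EFinD lee_fin.
apply: (@le_trans _ _ ((L ^+ d + e / (fine (leb E) + 1)) * fine (leb E))).
  by rewrite ler_wpM2r// ltW.
rewrite mulrDl lerD2l -mulrA -[leRHS]mulr1 ler_wpM2l ?(ltW e0)//.
by rewrite mulrC ler_pdivrMr ?ltr_wpDl// mul1r lerDl.
Qed.

End lipschitz_image.

(* In dimension 0 every box has volume 1 (an empty product), so [leb] is
   nonzero even on [set0]; hence every integral sum over the values of a simple
   function has infinite support and takes the default value 0 of [fsbig].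
   In particular no function is a probability density. *)
Section dimension0.
Context {R : realType}.

Lemma leb_dim0_gt0 (A : set (Rd R 0)) : (0 < leb A)%E.
Proof.
apply: (@lt_le_trans _ _ 1%E) => //; apply: le_ereal_inf_tmp => _ [B _ <-].
have vB k : box_vol (B k) = 1%E by rewrite /box_vol big_ord0.
have := @nneseries_lim_ge R (fun k => box_vol (B k)) xpredT 0%N 1%N.
by rewrite big_nat1 vB; apply => k _ _; rewrite vB.
Qed.

Lemma sintegral_dim0 (h : Rd R 0 -> R) : sintegral (@leb R 0) h = 0%E.
Proof.
apply: fsbig_dflt => fin.
(* Values start at 1 since the value 0 contributes a zero term; each positive integer contributes a
   nonzero one, attained or not. *)
apply: infinite_nat; pose succr (k : nat) : R := k.+1%:R.
have succr_inj i j : succr i = succr j -> i = j.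
  by move=> /eqP; rewrite eqr_nat eqSS => /eqP.
apply: (sub_finite_set _ (finite_preimage (in2W succr_inj) fin)) => k _.
split => //=.
apply/eqP; rewrite mule_eq0 negb_or eqe pnatr_eq0/=.
by rewrite gt_eqF// leb_dim0_gt0.
Qed.

Lemma integral_dim0_le0 (f : Rd R 0 -> \bar R) :
  (\int[@leb R 0]_(z in setT) f z <= 0)%E.
Proof.
rewrite /integral/=; apply: (@le_trans _ _ (0 - 0)%E); last by rewrite sube0.
(* The integral is a difference of suprema of simple integrals, all 0; the zero simple function
   bounds the second supremum below. *)
apply: leeB.
  by apply: ge_ereal_sup => _ [h _ <-]; rewrite sintegral_dim0.
apply: ereal_sup_ubound; exists nnsfun0; last exact: sintegral_dim0.
by move=> x; exact: funeneg_ge0.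
Qed.

End dimension0.

(** * Minorization of the kernel *)

Lemma measurable_fun_indic_compM (R : realType) (d1 d2 : measure_display)
    (T : measurableType d1) (U : measurableType d2)
    (g : T -> U) (phi : T -> R) (A : set U) :
  measurable_fun setT g -> measurable_fun setT phi -> measurable A ->
  measurable_fun setT (fun z => \1_A (g z) * phi z).
Proof.
move=> mg mphi mA; apply: measurable_funM => //.
exact: (measurableT_comp (measurable_indic mA) mg).
Qed.

Theorem theorem10 (R : realType) (d : nat)
  (f : d.-tuple R -> d.-tuple R -> d.-tuple R) (phi : d.-tuple R -> R)
  (Rr M : R) (y0 : d.-tuple R) (Lf Mt : R) :
  measurable_fun [set: d.-tuple R * d.-tuple R] (fun p => f p.1 p.2) ->
  prob_density phi ->
  0 < Rr -> 0 < M ->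
  (* (i) *)
  0 <= Lf -> (forall x, eball (origin R d) Rr x -> lipschitz_with Lf (f x)) ->
  (* (ii) *)
  0 < Mt -> (forall x, eball (origin R d) Rr x ->
                eball y0 M `<=` f x @` eball (origin R d) Mt) ->
  (* (iii) *)
  lsc_euclid phi -> (forall z, 0 < phi z) ->
  forall x, eball (origin R d) Rr x ->
  forall A : set (d.-tuple R), measurable A ->
  (((Lf ^- d)%:E * ereal_inf [set (phi z)%:E | z in eball (origin R d) Mt]
     * leb (A `&` eball y0 M) <= Kker f phi x A)%E).
Proof.
case: d f phi y0 => [|n] f phi y0 mf [mphi phi0 phi1] Rr0 M0 Lf0 fL Mt0 fonto
  _ _ x Bx A mA.
  (* In dimension 0 the density hypothesis would give [1 <= 0]. *)
  have := integral_dim0_le0 (fun z => (phi z)%:E).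
  by rewrite phi1 lee_fin ler10.
have K0 : (0 <= Kker f phi x A)%E.
  by apply: integral_ge0 => z _; rewrite lee_fin mulr_ge0.
(* For [Lf = 0] the inverse is 0 by convention, so the left side vanishes. *)
have [->|Lf_neq0] := eqVneq Lf 0.
  by rewrite expr0n/= invr0 mul0e mul0e.
have {Lf_neq0} L0 : 0 < Lf by rewrite lt_neqAle eq_sym Lf_neq0.
set B := eball (origin R n.+1) Mt.
pose c := ereal_inf [set (phi z)%:E | z in B].
have c0 : (0 <= c)%E by apply: le_ereal_inf_tmp => _ [z _ <-]; rewrite lee_fin.
have cphi z : B z -> (c <= (phi z)%:E)%E.
  by move=> Bz; apply: ereal_inf_lbound; exists z.
(* The infimum is finite because the ball contains the origin. *)
have /fineK cE : c \is a fin_num.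
  rewrite ge0_fin_numE// (le_lt_trans (cphi (origin R n.+1) _)) ?ltry//.
  rewrite /B/= /eball/= /edist big1 ?sqrtr0// => i _.
  by rewrite subrr expr0n.
have mfx : measurable_fun setT (f x).
  exact: (measurableT_comp mf (pair1_measurable x)).
pose E := B `&` f x @^-1` A.
have mE : measurable E.
  apply: measurableI; first exact: measurable_eball.
  by rewrite -[X in measurable X]setTI; exact: mfx.
have subE : A `&` eball y0 M `<=` f x @` E.
  move=> y [Ay /(fonto _ Bx)[z Bz zy]]; exists z => //.
  by split => //=; rewrite zy.
(* Multiplied by [Lf ^ d], this is the Lipschitz bound for the image of [E]. *)
apply: (@le_trans _ _ (c * leb E)%E).
  rewrite -/c -cE [X in (X * _)%E]muleC -muleA lee_wpmul2l ?lee_fin ?fine_ge0//.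
  rewrite lee_pdivrMl ?exprn_gt0//; apply: le_trans (le_leb subE) _.
  exact: lipschitz_leb (fL _ Bx) _.
apply: (@le_trans _ _ (\int[@leb R n.+1]_(z in setT) (fine c * \1_E z)%:E)%E).
  rewrite (integralZl_indic _ (fun=> E)) ?integral_indic ?setIT ?cE//.
  by rewrite ltNge fine_ge0.
apply: ge0_le_integral => //.
- by move=> z _; rewrite lee_fin mulr_ge0// fine_ge0.
- apply/measurable_EFinP; apply: measurable_funM => //; exact: measurable_indic.
- by apply/measurable_EFinP; exact: measurable_fun_indic_compM.
(* Pointwise comparison: on [B] the density is at least [c], and off [B] the left integrand is 0. *)
move=> z _; rewrite lee_fin /E indicI/= mulrCA mulrA [X in X <= _]mulrAC.
have -> : \1_(f x @^-1` A) z = \1_A (f x z) :> R by [].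
have [Bz|nBz] := pselect (B z).
  by rewrite indicE mem_set// mul1r ler_wpM2l// -lee_fin cE cphi.
by rewrite indicE memNset// !mul0r mulr_ge0.
Qed.
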